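(* Let $(E,\mathcal{P})$ be a random locally convex module over $\mathbb{R}$ with base $(\Omega,\mathcal{F},P)$ such that $E$ has the countable concatenation property, let $G$ be a nonempty $\mathcal{T}_{\varepsilon,\lambda}$-closed $L^0$-convex subset of $E$, and let $f:G\to\bar L^0(\mathcal{F})$ be a proper, stable, $\mathcal{T}_c$-lower semicontinuous and $L^0$-quasiconvex function. If $G$ is $L^0$-convexly compact (with respect to $\mathcal{T}_{\varepsilon,\lambda}$), then there exists $y_0\in G$ such that $f(y_0)=\bigwedge\{f(x) : x\in G\}$.
   Context: $(\Omega,\mathcal{F},P)$ is a probability space. $L^0(\mathcal{F})$ (resp. $\bar L^0(\mathcal{F})$) is the set of $P$-a.s. equivalence classes of real-valued (resp. extended real-valued) random variables, with the a.s. order $\le$; $\bar L^0(\mathcal{F})$ is a complete lattice with suprema $\bigvee$ and infima $\bigwedge$. ''$\xi>\eta$ on $A$'' means $\xi(\omega)>\eta(\omega)$ for a.e. $\omega\in A$. $L^0_+(\mathcal{F})=\{\xi\in L^0(\mathcal F):\xi\ge0\}$, $L^0_{++}(\mathcal{F})=\{\xi\in L^0(\mathcal F):\xi>0\text{ on }\Omega\}$. $\tilde I_A$ is the class of the indicator of $A\in\mathcal{F}$. Convention: $0\cdot(\pm\infty)=0$, $+\infty\pm(-\infty)=+\infty$. Random locally convex module over $\mathbb{R}$ with base $(\Omega,\mathcal F,P)$: a pair $(E,\mathcal{P})$ with $E$ a left $L^0(\mathcal{F})$-module and $\mathcal{P}$ a family of $L^0$-seminorms $\|\cdot\|:E\to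 L^0_+(\mathcal{F})$ (i.e. $\|\xi x\|=|\xi|\|x\|$, $\|x+y\|\le\|x\|+\|y\|$ for $\xi\in L^0(\mathcal F)$, $x,y\in E$) such that $\bigvee\{\|x\|:\|\cdot\|\in\mathcal{P}\}=0$ implies $x=\theta$ (the null element). For finite nonempty $Q\subset\mathcal{P}$, $\|x\|_Q=\bigvee\{\|x\|:\|\cdot\|\in Q\}$. The $(\varepsilon,\lambda)$-topology $\mathcal{T}_{\varepsilon,\lambda}$ on $E$ has local base at $\theta$ the sets $\{x:P\{\|x\|_Q<\varepsilon\}>1-\lambda\}$ ($Q\subset\mathcal P$ finite nonempty, $\varepsilon>0$, $0<\lambda<1$); the locally $L^0$-convex topology $\mathcal{T}_c$ has local base at $\theta$ the sets $\{x:\|x\|_Q\le\varepsilon\}$ ($Q\subset\mathcal P$ finite nonempty, $\varepsilon\in L^0_{++}(\mathcal{F})$). A subset $G$ of $E$ has the countable concatenation property if for each sequence $\{g_n\}$ in $G$ and each countable partition $\{A_n\}$ of $\Omega$ into members of $\mathcal{F}$ there is $g\in G$ with $\tilde I_{A_n}g=\tilde I_{A_n}g_n$ for all $n$. $G$ is $L^0$-convex if $\xi x+(1-\xi)y\in G$ for $x,y\in G$, $\xi\in L^0_+(\mathcal{F})$, $0\le\xi\le1$. A $\mathcal{T}_{\varepsilon,\lambda}$-closed $L^0$-convex set $G$ is $L^0$-convexly compact if any family of $\mathcal{T}_{\varepsilon,\lambda}$-closed $L^0$-convex subsets of $G$ with the finite intersection property has nonempty intersection. A function $f:G\to\bar L^0(\mathcal{F})$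 is: proper if $f(x)>-\infty$ on $\Omega$ for all $x\in G$ and $f(x)\in L^0(\mathcal{F})$ for some $x\in G$; stable if $f(\tilde I_Ax+\tilde I_{A^c}y)=\tilde I_Af(x)+\tilde I_{A^c}f(y)$ for all $x,y\in G$, $A\in\mathcal{F}$; $\mathcal{T}_c$-lower semicontinuous if $f$ is proper and $\{x\in G: f(x)\le\eta\}$ is $\mathcal{T}_c$-closed for all $\eta\in L^0(\mathcal{F})$; $L^0$-quasiconvex if $f$ is proper and $\{x\in G:f(x)\le\eta\}$ is $L^0$-convex for all $\eta\in L^0(\mathcal{F})$. *)

(* Defs.v *)
From HB Require Import structures.
From mathcomp Require Import all_boot all_order all_algebra.
From mathcomp Require Import all_classical all_reals all_analysis.
From mathcomp Require Import measurable_realfun.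

Set Implicit Arguments.
Unset Strict Implicit.
Unset Printing Implicit Defensive.
Import Order.TTheory GRing.Theory Num.Theory.
Import numFieldNormedType.Exports.
Local Open Scope classical_set_scope.
Local Open Scope ring_scope.
Local Open Scope quotient_scope.

Section L0_def.
Context {d : measure_display} {T : measurableType d} {R : realType}.
Variable P : probability T R.

(* Elements coerce to functions T -> R (resp. T -> \bar R) through the chosen
   representative of the class; the definitions below only look at these
   representatives up to P-null sets. *)
Definition L0 : Type := {mfun_ P, T >-> R}.
Definition L0bar : Type := {mfun_ P, T >-> \bar R}.
HB.instance Definition _ := Choice.on L0.
HB.instance Definition _ := EqQuotient.on L0.
HB.instance Definition _ := Choice.on L0bar.
HB.instance Definition _ := EqQuotient.on L0bar.
Definition L0_fun (f : L0) : T -> R := aqEqMfun_to_fun f.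
Definition L0bar_fun (f : L0bar) : T -> \bar R := aqEqMfun_to_fun f.

End L0_def.
Coercion L0_fun : L0 >-> Funclass.
Coercion L0bar_fun : L0bar >-> Funclass.

Section L0_theory.
Context {d : measure_display} {T : measurableType d} {R : realType}.
Variable P : probability T R.
Local Notation L0 := (L0 P).
Local Notation L0bar := (L0bar P).

Definition toL0 (f : {mfun T >-> R}) : L0 := \pi_L0 f.
Definition toL0bar (f : {mfun T >-> \bar R}) : L0bar := \pi_L0bar f.

Lemma toL0E (f : {mfun T >-> R}) :
  {ae P, forall w, toL0 f w = f w}.
Proof.
have /eqP : \pi_L0 (repr (toL0 f)) = \pi_L0 f by rewrite reprK.
by rewrite eqmodE => /asboolP; apply: filterS => w; exact.
Qed.

Lemma toL0barE (f : {mfun T >-> \bar R}) :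
  {ae P, forall w, toL0bar f w = f w}.
Proof.
have /eqP : \pi_L0bar (repr (toL0bar f)) = \pi_L0bar f by rewrite reprK.
by rewrite eqmodE => /asboolP; apply: filterS => w; exact.
Qed.

Lemma L0P (f g : L0) : {ae P, forall w, f w = g w} -> f = g.
Proof.
move=> fg; rewrite -[f]reprK -[g]reprK; apply/eqP; rewrite eqmodE.
by apply/asboolP; apply: filterS fg => w + _.
Qed.

Lemma L0barP (f g : L0bar) : {ae P, forall w, f w = g w} -> f = g.
Proof.
move=> fg; rewrite -[f]reprK -[g]reprK; apply/eqP; rewrite eqmodE.
by apply/asboolP; apply: filterS fg => w + _.
Qed.

Definition L0_repr (f : L0) : {mfun T >-> R} := repr f.
Definition L0bar_repr (f : L0bar) : {mfun T >-> \bar R} := repr f.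

Definition L0_add (f g : L0) := toL0 (L0_repr f + L0_repr g : {mfun T >-> R}).
Definition L0_opp (f : L0) := toL0 (- L0_repr f : {mfun T >-> R}).
Definition L0_mul (f g : L0) := toL0 (L0_repr f * L0_repr g : {mfun T >-> R}).
Definition L0_zero := toL0 (0 : {mfun T >-> R}).
Definition L0_one := toL0 (1 : {mfun T >-> R}).

Lemma L0_addE f g : {ae P, forall w, L0_add f g w = f w + g w}.
Proof. exact: toL0E. Qed.
Lemma L0_oppE f : {ae P, forall w, L0_opp f w = - f w}.
Proof. exact: toL0E. Qed.
Lemma L0_mulE f g : {ae P, forall w, L0_mul f g w = f w * g w}.
Proof. exact: toL0E. Qed.
Lemma L0_zeroE : {ae P, forall w, L0_zero w = 0}.
Proof. exact: toL0E. Qed.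
Lemma L0_oneE : {ae P, forall w, L0_one w = 1}.
Proof. exact: toL0E. Qed.

Lemma L0_addA : associative (@L0_add).
Proof.
move=> f g h; apply: L0P; near=> w.
rewrite (near (L0_addE f (L0_add g h)) w)// (near (L0_addE g h) w)//.
by rewrite (near (L0_addE (L0_add f g) h) w)// (near (L0_addE f g) w)// addrA.
Unshelve. all: by end_near. Qed.

Lemma L0_addC : commutative (@L0_add).
Proof.
move=> f g; apply: L0P; near=> w.
by rewrite (near (L0_addE f g) w)// (near (L0_addE g f) w)// addrC.
Unshelve. all: by end_near. Qed.

Lemma L0_add0 : left_id L0_zero L0_add.
Proof.
move=> f; apply: L0P; near=> w.
by rewrite (near (L0_addE L0_zero f) w)// (near L0_zeroE w)// add0r.
Unshelve. all: by end_near. Qed.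

Lemma L0_addN : left_inverse L0_zero L0_opp L0_add.
Proof.
move=> f; apply: L0P; near=> w.
rewrite (near (L0_addE (L0_opp f) f) w)// (near L0_zeroE w)//.
by rewrite (near (L0_oppE f) w)// addNr.
Unshelve. all: by end_near. Qed.

Lemma L0_mulA : associative (@L0_mul).
Proof.
move=> f g h; apply: L0P; near=> w.
rewrite (near (L0_mulE f (L0_mul g h)) w)// (near (L0_mulE g h) w)//.
by rewrite (near (L0_mulE (L0_mul f g) h) w)// (near (L0_mulE f g) w)// mulrA.
Unshelve. all: by end_near. Qed.

Lemma L0_mulC : commutative (@L0_mul).
Proof.
move=> f g; apply: L0P; near=> w.
by rewrite (near (L0_mulE f g) w)// (near (L0_mulE g f) w)// mulrC.
Unshelve. all: by end_near. Qed.

Lemma L0_mul1 : left_id L0_one L0_mul.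
Proof.
move=> f; apply: L0P; near=> w.
by rewrite (near (L0_mulE L0_one f) w)// (near L0_oneE w)// mul1r.
Unshelve. all: by end_near. Qed.

Lemma L0_mulDl : left_distributive L0_mul L0_add.
Proof.
move=> f g h; apply: L0P; near=> w.
rewrite (near (L0_mulE (L0_add f g) h) w)// (near (L0_addE f g) w)//.
rewrite (near (L0_addE (L0_mul f h) (L0_mul g h)) w)//.
by rewrite (near (L0_mulE f h) w)// (near (L0_mulE g h) w)// mulrDl.
Unshelve. all: by end_near. Qed.

HB.instance Definition _ := GRing.isZmodule.Build L0
  L0_addA L0_addC L0_add0 L0_addN.
HB.instance Definition _ := GRing.Zmodule_isComPzRing.Build L0
  L0_mulA L0_mulC L0_mul1 L0_mulDl.

Definition L0_le (f g : L0) : bool := `[< {ae P, forall w, f w <= g w} >].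

Lemma L0_le_refl : reflexive L0_le.
Proof. by move=> f; apply/asboolP; near=> w. Unshelve. all: by end_near. Qed.

Lemma L0_le_anti : antisymmetric L0_le.
Proof.
move=> f g /andP[/asboolP fg /asboolP gf]; apply: L0P.
by apply: filterS2 fg gf => w fg gf; apply/le_anti/andP.
Qed.

Lemma L0_le_trans : transitive L0_le.
Proof.
move=> g f h /asboolP fg /asboolP gh; apply/asboolP.
by apply: filterS2 fg gh => w; exact: le_trans.
Qed.

HB.instance Definition _ := Order.Le_isPOrder.Build ring_display L0
  L0_le_refl L0_le_anti L0_le_trans.

Definition L0bar_le (f g : L0bar) : bool :=
  `[< {ae P, forall w, (f w <= g w)%E} >].

Lemma L0bar_le_refl : reflexive L0bar_le.
Proof. by move=> f; apply/asboolP; near=> w. Unshelve. all: by end_near. Qed.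

Lemma L0bar_le_anti : antisymmetric L0bar_le.
Proof.
move=> f g /andP[/asboolP fg /asboolP gf]; apply: L0barP.
by apply: filterS2 fg gf => w fg gf; apply/le_anti/andP.
Qed.

Lemma L0bar_le_trans : transitive L0bar_le.
Proof.
move=> g f h /asboolP fg /asboolP gh; apply/asboolP.
by apply: filterS2 fg gh => w; exact: le_trans.
Qed.

HB.instance Definition _ := Order.Le_isPOrder.Build ring_display L0bar
  L0bar_le_refl L0bar_le_anti L0bar_le_trans.

Lemma L0_leP (f g : L0) : reflect {ae P, forall w, f w <= g w} (f <= g).
Proof. exact: asboolP. Qed.

Lemma L0bar_leP (f g : L0bar) :
  reflect {ae P, forall w, (f w <= g w)%E} (f <= g).
Proof. exact: asboolP. Qed.

Definition L0_abs (f : L0) : L0 :=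
  toL0 ([the {mfun R >-> R} of @Num.norm R R] \o L0_repr f).

Definition L0_max (f g : L0) : L0 := toL0 (max_mfun (L0_repr f) (L0_repr g)).

Definition L0_indic (A : set T) (mA : measurable A) : L0 :=
  toL0 (indic_mfun A mA).

Definition L0_pos : set L0 := [set f | {ae P, forall w, 0 < f w}].

Lemma EFin_L0_measurable (f : L0) : measurable_fun setT (fun w => (f w)%:E).
Proof. by apply/measurable_EFinP; exact: (measurable_funPT (L0_repr f)). Qed.

Definition EFin_L0 (f : L0) : L0bar :=
  toL0bar (mfun_Sub (mem_set (EFin_L0_measurable f))).

(* `dual_adde` is the addition of \bar R with +oo + -oo = +oo; `mule` satisfies
   0 * +oo = 0 * -oo = 0. *)
Lemma L0bar_add_measurable (f g : L0bar) :
  measurable_fun setT (fun w => dual_adde (f w) (g w) : \bar R).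
Proof.
have -> : (fun w => dual_adde (f w) (g w)) = (fun w => - (- f w - g w))%E.
  apply/funext => w; case: (f w) (g w) => [a| |] [b| |] //=.
  by change ((a + b)%:E = (- (- a - b))%:E); rewrite opprB opprK addrC.
by apply: measurableT_comp => //; apply: emeasurable_funD;
  apply: measurableT_comp => //; exact: (measurable_funPT (L0bar_repr _)).
Qed.

Definition L0bar_add (f g : L0bar) : L0bar :=
  toL0bar (mfun_Sub (mem_set (L0bar_add_measurable f g))).

Lemma L0bar_mul_measurable (f g : L0bar) :
  measurable_fun setT (fun w => (f w * g w)%E).
Proof.
by apply: emeasurable_funM; exact: (measurable_funPT (L0bar_repr _)).
Qed.

Definition L0bar_mul (f g : L0bar) : L0bar :=
  toL0bar (mfun_Sub (mem_set (L0bar_mul_measurable f g))).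

End L0_theory.

HB.mixin Record isRandomLocallyConvex (d : measure_display)
    (T : measurableType d) (R : realType) (P : probability T R) E
    & GRing.Lmodule (L0 P) E := {
  seminorms : set (E -> L0 P);
  (* without it there is no neighbourhood base at 0 *)
  seminorms_nonempty : seminorms !=set0;
  seminorm_ge0 : forall p, seminorms p -> forall x, 0 <= p x;
  seminormZ : forall p, seminorms p ->
    forall (xi : L0 P) x, p (xi *: x) = L0_abs xi * p x;
  seminormD : forall p, seminorms p -> forall x y, p (x + y) <= p x + p y;
  seminorms_separated : forall x,
    supremums [set EFin_L0 (p x) | p in seminorms] (EFin_L0 0) -> x = 0
}.

#[short(type="randomLocallyConvexType")]
HB.structure Definition RandomLocallyConvex (d : measure_display)
    (T : measurableType d) (R : realType) (P : probability T R) :=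
  {E of GRing.Lmodule (L0 P) E & isRandomLocallyConvex d T R P E}.

Section finite_sup.
Context {d : measure_display} {T : measurableType d} {R : realType}.
Context {P : probability T R}.

Lemma L0_supremums_max (A : set (L0 P)) f s :
  supremums A s -> supremums (f |` A) (L0_max f s).
Proof.
move=> [ubs lbs]; have mE := toL0E P (max_mfun (L0_repr f) (L0_repr s)).
split=> [x [->|Ax]|y yub].
- by apply/L0_leP; apply: filterS mE => w ->; rewrite le_max lexx.
- apply/L0_leP; move/L0_leP: (ubs x Ax) => xs.
  by apply: filterS2 mE xs => w -> xs; rewrite le_max xs orbT.
- have /L0_leP fy : f <= y by apply: yub; left.
  have /L0_leP sy : s <= y by apply: lbs => x Ax; apply: yub; right.
  by apply/L0_leP; apply: filterS3 mE fy sy => w -> fy sy; rewrite ge_max fy.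
Qed.

Lemma L0_supremums_finite (A : set (L0 P)) :
  finite_set A -> A !=set0 -> supremums A !=set0.
Proof.
move=> /finite_setP[n]; elim: n A => [A|n IHn A /eq_cardSP[x Ax An] _].
  by rewrite II0 card_eq0 => /eqP -> [].
rewrite -(setD1K Ax); have [A0|/set0P A0] := eqVneq (A `\ x) set0.
  by exists x; rewrite A0 setU0 supremums1.
by have [s sA] := IHn _ An A0; exists (L0_max x s); exact: L0_supremums_max.
Qed.

End finite_sup.

Section topologies.
Context {d : measure_display} {T : measurableType d} {R : realType}.
Context {P : probability T R}.
Variable E : randomLocallyConvexType P.
Implicit Types (Q : set (E -> L0 P)) (x y : E) (U : set E).

(* For Q finite and nonempty the supremum exists (L0_supremums_finite), so the
   default value 0 is not used. *)
Definition sup_seminorm Q x : L0 P := supremum 0 [set p x | p in Q].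

Definition seminorm_index Q :=
  [/\ finite_set Q, Q !=set0 & Q `<=` @seminorms d T R P E].

Definition eps_lambda_nbhs0 Q (eps lam : R) : set E :=
  [set x | ((1 - lam)%:E < P [set w | (sup_seminorm Q x w < eps)%R])%E].

Definition L0_nbhs0 Q (eps : L0 P) : set E := [set x | sup_seminorm Q x <= eps].

Definition eps_lambda_open U := forall x, U x ->
  exists Q eps lam, [/\ seminorm_index Q, 0 < eps, 0 < lam < 1 &
    forall y, eps_lambda_nbhs0 Q eps lam (y - x) -> U y].

Definition locL0_open U := forall x, U x ->
  exists Q eps, [/\ seminorm_index Q, L0_pos eps &
    forall y, L0_nbhs0 Q eps (y - x) -> U y].

Lemma seminorm_indexU Q1 Q2 :
  seminorm_index Q1 -> seminorm_index Q2 -> seminorm_index (Q1 `|` Q2).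
Proof.
move=> [f1 [p Q1p] s1] [f2 _ s2]; split; first by rewrite finite_setU.
  by exists p; left.
by move=> q [/s1|/s2].
Qed.

Lemma sup_seminorm_le Q Q' x : seminorm_index Q -> seminorm_index Q' ->
  Q `<=` Q' -> sup_seminorm Q x <= sup_seminorm Q' x.
Proof.
have supP S : seminorm_index S ->
    supremums [set p x | p in S] (sup_seminorm S x).
  move=> [fS [p Sp] _].
  have S0 : [set p x | p in S] !=set0 by exists (p x), p.
  have [s sS] := L0_supremums_finite (finite_image (fun p => p x) fS) S0.
  rewrite /sup_seminorm /supremum; case: eqP => [S00|_].
    by move: S0; rewrite S00 => -[].
  by case: xgetP => [y _ //|/(_ s)].
move=> /supP[_ lbs] /supP[ubs' _] QQ'; apply: lbs => _ [p Qp <-].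
by apply: ubs'; exists p => //; exact: QQ'.
Qed.

Lemma seminorm_index_ex : exists Q, seminorm_index Q.
Proof.
have [p Ep] := @seminorms_nonempty d T R P E.
by exists [set p]; split; [exact: finite_set1|exists p|move=> _ ->].
Qed.

Lemma eps_lambda_openT : eps_lambda_open setT.
Proof.
move=> x _; have [Q iQ] := seminorm_index_ex.
exists Q, 1, (2^-1); split=> //.
by rewrite invr_gt0 ltr0n invf_lt1 ?ltr0n// ltr1n.
Qed.

Lemma measurable_sup_seminorm Q x (e : R) :
  measurable [set w | sup_seminorm Q x w < e].
Proof.
rewrite -[X in measurable X]setTI.
have -> : [set w | sup_seminorm Q x w < e] =
    L0_repr (sup_seminorm Q x) @^-1` `]-oo, e[.
  by apply/seteqP; split=> w; rewrite /= in_itv.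
exact: (measurable_funPT (L0_repr (sup_seminorm Q x))).
Qed.

Lemma eps_lambda_nbhs0_le Q Q' (eps eps' lam lam' : R) x :
  seminorm_index Q -> seminorm_index Q' -> Q `<=` Q' -> eps' <= eps ->
  lam' <= lam -> eps_lambda_nbhs0 Q' eps' lam' x -> eps_lambda_nbhs0 Q eps lam x.
Proof.
move=> iQ iQ' QQ' ee ll; rewrite /eps_lambda_nbhs0 /= => h.
apply: (@le_lt_trans _ _ (1 - lam')%:E); first by rewrite lee_fin lerB.
apply: (lt_le_trans h); have /L0_leP := sup_seminorm_le x iQ iQ' QQ'.
move=> [N [mN N0 QN]].
rewrite -[leRHS](measureU0 _ mN N0); last exact: measurable_sup_seminorm.
rewrite le_measure ?inE//; [exact: measurable_sup_seminorm| |].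
  by apply: measurableU => //; exact: measurable_sup_seminorm.
move=> w /= we; have [wQ|wQ] := leP (sup_seminorm Q x w) (sup_seminorm Q' x w).
  by left; apply: (le_lt_trans wQ); exact: lt_le_trans ee.
by right; apply: QN => /=; apply/negP; rewrite -ltNge.
Qed.

Lemma eps_lambda_openI : setI_closed eps_lambda_open.
Proof.
move=> U V oU oV x [Ux Vx].
have [Q1 [e1 [l1 [i1 e10 /andP[l10 l11] UQ]]]] := oU x Ux.
have [Q2 [e2 [l2 [i2 e20 /andP[l20 l21] VQ]]]] := oV x Vx.
have i12 := seminorm_indexU i1 i2.
exists (Q1 `|` Q2), (Num.min e1 e2), (Num.min l1 l2); split=> //.
- by rewrite lt_min e10.
- by rewrite lt_min l10 l20/= gt_min l11.
- move=> y Qy; split.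
  + apply: UQ; apply: eps_lambda_nbhs0_le Qy => //.
    * by rewrite ge_min lexx.
    * by rewrite ge_min lexx.
  + apply: VQ; apply: eps_lambda_nbhs0_le Qy => //.
    * by rewrite ge_min lexx orbT.
    * by rewrite ge_min lexx orbT.
Qed.

Lemma eps_lambda_open_bigU (I : Type) (f : I -> set E) :
  (forall i, eps_lambda_open (f i)) -> eps_lambda_open (\bigcup_i f i).
Proof.
move=> of_ x [i _ fix_].
have [Q [e [l [iQ e0 l01 Qf]]]] := of_ i x fix_.
by exists Q, e, l; split=> // y /Qf fy; exists i.
Qed.

Lemma locL0_openT : locL0_open setT.
Proof.
move=> x _; have [Q iQ] := seminorm_index_ex; exists Q, 1; split=> //.
by apply: filterS (L0_oneE P) => w; rewrite /L0_pos /= => ->.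
Qed.

Lemma locL0_openI : setI_closed locL0_open.
Proof.
move=> U V oU oV x [Ux Vx].
have [Q1 [e1 [i1 e10 UQ]]] := oU x Ux.
have [Q2 [e2 [i2 e20 VQ]]] := oV x Vx.
have i12 := seminorm_indexU i1 i2.
pose e : L0 P := toL0 P (min_mfun (L0_repr e1) (L0_repr e2)).
have eE := toL0E P (min_mfun (L0_repr e1) (L0_repr e2)).
exists (Q1 `|` Q2), e; split=> //.
  by apply: filterS3 eE e10 e20 => w -> e10 e20; rewrite lt_min e10.
move=> y Qy; split.
- apply: UQ; apply: (le_trans (sup_seminorm_le _ i1 i12 _)) => //.
  apply: (le_trans Qy); apply/L0_leP.
  by apply: filterS eE => w ->; rewrite ge_min lexx.
- apply: VQ; apply: (le_trans (sup_seminorm_le _ i2 i12 _)) => //.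
  apply: (le_trans Qy); apply/L0_leP.
  by apply: filterS eE => w ->; rewrite ge_min lexx orbT.
Qed.

Lemma locL0_open_bigU (I : Type) (f : I -> set E) :
  (forall i, locL0_open (f i)) -> locL0_open (\bigcup_i f i).
Proof.
move=> of_ x [i _ fix_].
have [Q [e [iQ e0 Qf]]] := of_ i x fix_.
by exists Q, e; split=> // y /Qf fy; exists i.
Qed.

(* E with the (epsilon, lambda)-topology, resp. the locally L0-convex one *)
Definition eps_lambda : Type := E.
HB.instance Definition _ := Choice.on eps_lambda.
HB.instance Definition _ := @isOpenTopological.Build eps_lambda
  eps_lambda_open eps_lambda_openT eps_lambda_openI eps_lambda_open_bigU.

Definition locL0 : Type := E.
HB.instance Definition _ := Choice.on locL0.
HB.instance Definition _ := @isOpenTopological.Build locL0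
  locL0_open locL0_openT locL0_openI locL0_open_bigU.

Lemma eps_lambda_openE U : open (U : set eps_lambda) = eps_lambda_open U.
Proof. by []. Qed.

Lemma locL0_openE U : open (U : set locL0) = locL0_open U.
Proof. by []. Qed.

End topologies.

Section notions.
Context {d : measure_display} {T : measurableType d} {R : realType}.
Context {P : probability T R} {E : randomLocallyConvexType P}.
Implicit Types (G : set E) (f : E -> L0bar P).

Definition eps_lambda_closed G := closed (G : set (eps_lambda E)).
Definition locL0_closed G := closed (G : set (locL0 E)).

(* blocks of the partition may be empty, which covers finite partitions *)
Definition countable_concatenation G :=
  forall (g : nat -> E) (A : nat -> set T) (mA : forall n, measurable (A n)),
    (forall n, G (g n)) -> trivIset setT A -> \bigcup_n A n = setT ->
    exists2 x, G x & forall n, L0_indic P (mA n) *: x = L0_indic P (mA n) *: g n.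

Definition L0_convex G := forall x y (xi : L0 P),
  G x -> G y -> 0 <= xi -> xi <= 1 -> G (xi *: x + (1 - xi) *: y).

Definition L0_convexly_compact G :=
  [/\ eps_lambda_closed G, L0_convex G &
   forall (I : choiceType) (D : set I) (F : I -> set E),
    (forall i, D i ->
      [/\ F i `<=` G, eps_lambda_closed (F i) & L0_convex (F i)]) ->
    finI D F -> \bigcap_(i in D) F i !=set0].

(* A function on G is given by f : E -> L0bar P, of which only the values on G
   are used. *)
Definition sublevel G f (eta : L0 P) := [set x | G x /\ f x <= EFin_L0 eta].

Definition L0_proper G f :=
  (forall x, G x -> {ae P, forall w, (-oo < f x w)%E}) /\
  (exists2 x, G x & exists xi : L0 P, f x = EFin_L0 xi).

Definition L0_stable G f :=
  forall x y (A : set T) (mA : measurable A), G x -> G y ->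
    f (L0_indic P mA *: x + L0_indic P (measurableC mA) *: y) =
    L0bar_add (L0bar_mul (EFin_L0 (L0_indic P mA)) (f x))
              (L0bar_mul (EFin_L0 (L0_indic P (measurableC mA))) (f y)).

Definition locL0_lsc G f :=
  L0_proper G f /\ forall eta, locL0_closed (sublevel G f eta).

Definition L0_quasiconvex G f :=
  L0_proper G f /\ forall eta, L0_convex (sublevel G f eta).

End notions.

(* Main.v *)
(* Pasting two points along {f x <= f y} shows, by stability, that the values of
   f are directed downwards, so the sublevel sets {f <= f x} with f x finite
   have the finite intersection property, and a common point is a minimizer.
   Convex compactness only applies to sets closed for the (epsilon, lambda)
   topology. A T_c-closed set S with the countable concatenation property is
   such a set: given x in its (epsilon, lambda)-closure and a neighbourhood
   {|y - x|_Q <= e}, choose y_n in S with P(|y_n - x|_Q <= e) -> 1; these events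
   cover Omega up to a null set, and concatenating the y_n along them gives a
   point of S in that neighbourhood. *)

Require Import Defs.
From mathcomp Require Import all_boot all_order all_algebra.
From mathcomp Require Import all_classical all_reals all_analysis.
From mathcomp Require Import measurable_realfun lra.

Set Implicit Arguments.
Unset Strict Implicit.
Unset Printing Implicit Defensive.
Import Order.TTheory GRing.Theory Num.Theory.
Import numFieldNormedType.Exports.
Local Open Scope classical_set_scope.
Local Open Scope ring_scope.

(** * Arithmetic of indicator classes *)

Section indicators.
Context {d : measure_display} {T : measurableType d} {R : realType}.
Context {P : probability T R}.
Implicit Types A B : set T.

Lemma L0_indicE A (mA : measurable A) :
  {ae P, forall w, L0_indic P mA w = \1_A w}.
Proof. exact: toL0E. Qed.

Lemma L0_absE (f : L0 P) : {ae P, forall w, L0_abs f w = `|f w|}.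
Proof. exact: toL0E. Qed.

Lemma EFin_L0E (f : L0 P) : {ae P, forall w, EFin_L0 f w = (f w)%:E}.
Proof. exact: toL0barE. Qed.

Lemma L0_indic_ge0 A (mA : measurable A) : 0 <= L0_indic P mA.
Proof.
apply/L0_leP; apply: filterS2 (L0_indicE mA) (L0_zeroE P) => w -> ->.
by rewrite indicE ler0n.
Qed.

Lemma L0_indic_le1 A (mA : measurable A) : L0_indic P mA <= 1.
Proof.
apply/L0_leP; apply: filterS2 (L0_indicE mA) (L0_oneE P) => w -> ->.
by rewrite indicE lern1 leq_b1.
Qed.

Lemma L0_indicC A (mA : measurable A) :
  L0_indic P (measurableC mA) = 1 - L0_indic P mA.
Proof.
apply: L0P; near=> w.
have -> : L0_fun (1 - L0_indic P mA) w = L0_one P w + L0_opp (L0_indic P mA) w.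
  by near: w; exact: L0_addE.
rewrite (near (L0_indicE (measurableC mA)) w)// (near (L0_oneE P) w)//.
rewrite (near (L0_oppE (L0_indic P mA)) w)// (near (L0_indicE mA) w)//.
by rewrite !indicE in_setC; case: (w \in A); rewrite ?subrr ?subr0.
Unshelve. all: by end_near. Qed.

Lemma L0_indicI A B (mA : measurable A) (mB : measurable B) :
  L0_indic P mA * L0_indic P mB = L0_indic P (measurableI _ _ mA mB).
Proof.
apply: L0P; near=> w.
have -> : L0_fun (L0_indic P mA * L0_indic P mB) w = L0_indic P mA w * L0_indic P mB w.
  by near: w; exact: L0_mulE.
rewrite (near (L0_indicE mA) w)// (near (L0_indicE mB) w)//.
rewrite (near (L0_indicE (measurableI _ _ mA mB)) w)//.
by rewrite !indicE in_setI -natrM mulnb.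
Unshelve. all: by end_near. Qed.

Lemma L0_indic_sub A B (mA : measurable A) (mB : measurable B) :
  A `<=` B -> L0_indic P mA * L0_indic P mB = L0_indic P mA.
Proof.
move=> AB; rewrite L0_indicI; apply: L0P.
apply: filterS2 (L0_indicE mA) (L0_indicE (measurableI _ _ mA mB)) => w -> ->.
by rewrite (setIidl AB).
Qed.

Lemma L0_indic_disj A B (mA : measurable A) (mB : measurable B) :
  A `<=` ~` B -> L0_indic P mA * L0_indic P mB = 0.
Proof.
move=> /disjoints_subset AB; rewrite L0_indicI; apply: L0P.
apply: filterS2 (L0_zeroE P) (L0_indicE (measurableI _ _ mA mB)) => w -> ->.
by rewrite AB indic0.
Qed.

End indicators.

(** * Pasting along an event; locality of seminorms and of stable functions *)

Section pasting.
Context {d : measure_display} {T : measurableType d} {R : realType}.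
Context {P : probability T R} {E : randomLocallyConvexType P}.
Implicit Types (A B : set T) (x y : E) (G : set E) (f : E -> L0bar P).

(** Has the form of the argument of [f] in [L0_stable], so stability applies to it verbatim. *)
Definition paste A (mA : measurable A) x y : E :=
  L0_indic P mA *: x + L0_indic P (measurableC mA) *: y.

Lemma indic_pastel A B (mA : measurable A) (mB : measurable B) x y :
  B `<=` A -> L0_indic P mB *: paste mA x y = L0_indic P mB *: x.
Proof.
move=> BA; rewrite /paste scalerDr !scalerA L0_indic_sub//.
by rewrite L0_indic_disj ?setCK// scale0r addr0.
Qed.

Lemma indic_paster A B (mA : measurable A) (mB : measurable B) x y :
  B `<=` ~` A -> L0_indic P mB *: paste mA x y = L0_indic P mB *: y.
Proof.
move=> BA; rewrite /paste scalerDr !scalerA L0_indic_disj// scale0r add0r.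
by rewrite L0_indic_sub.
Qed.

Lemma paste_eqr A (mA : measurable A) x y :
  L0_indic P mA *: x = L0_indic P mA *: y -> paste mA x y = y.
Proof.
by move=> xy; rewrite /paste xy L0_indicC -scalerDl addrC subrK scale1r.
Qed.

(** A pasting is an [L0]-convex combination whose coefficient is an indicator. *)
Lemma L0_convex_paste G A (mA : measurable A) x y :
  L0_convex G -> G x -> G y -> G (paste mA x y).
Proof.
move=> cG Gx Gy; rewrite /paste L0_indicC.
exact: cG (L0_indic_ge0 mA) (L0_indic_le1 mA).
Qed.

(** By homogeneity [p] commutes with multiplication by the indicator of [A], so on [A] the value
    [p x] depends only on the restriction of [x] to [A]. *)
Lemma seminorm_local p A (mA : measurable A) x y : @seminorms d T R P E p ->
  L0_indic P mA *: x = L0_indic P mA *: y ->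
  {ae P, forall w, A w -> p x w = p y w}.
Proof.
move=> pE xy.
have pA z : {ae P, forall w, A w -> p (L0_indic P mA *: z) w = p z w}.
  rewrite (seminormZ _ pE); near=> w => Aw.
  have -> : L0_fun (L0_abs (L0_indic P mA) * p z) w = L0_abs (L0_indic P mA) w * p z w.
    by near: w; exact: L0_mulE.
  rewrite (near (L0_absE (L0_indic P mA)) w)// (near (L0_indicE mA) w)//.
  by rewrite indicE mem_set// normr1 mul1r.
by apply: filterS2 (pA x) (pA y) => w + + Aw => <-// <-//; rewrite xy.
Unshelve. all: by end_near. Qed.

Lemma sup_seminormP Q x : seminorm_index Q ->
  supremums [set p x | p in Q] (sup_seminorm Q x).
Proof.
move=> [fQ [p Qp] _].
have Q0 : [set p x | p in Q] !=set0 by exists (p x), p.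
have [s sQ] := L0_supremums_finite (finite_image (fun p => p x) fQ) Q0.
rewrite /sup_seminorm /supremum; case: eqP => [Q00|_].
  by move: Q0; rewrite Q00 => -[].
by case: xgetP => [y _ //|/(_ s)].
Qed.

(** The supremum is known only through the order of [L0], not pointwise. By symmetry one inequality
    on [A] is enough, and it follows by testing leastness of the supremum against a pasted upper
    bound. *)
Lemma sup_seminorm_local Q A (mA : measurable A) x y : seminorm_index Q ->
  L0_indic P mA *: x = L0_indic P mA *: y ->
  {ae P, forall w, A w -> sup_seminorm Q x w = sup_seminorm Q y w}.
Proof.
move=> iQ.
suff H u v : L0_indic P mA *: u = L0_indic P mA *: v ->
    {ae P, forall w, A w -> sup_seminorm Q u w <= sup_seminorm Q v w}.
  move=> xy; apply: filterS2 (H x y xy) (H y x (esym xy)) => w + + Aw.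
  by move=> /(_ Aw) h /(_ Aw) k; apply/le_anti/andP.
move=> uv; have [ubu lbu] := sup_seminormP u iQ.
have [ubv _] := sup_seminormP v iQ.
(* s is sup_seminorm Q v on A and sup_seminorm Q u off A: it bounds every p u. *)
pose s : L0 P := L0_indic P mA * sup_seminorm Q v +
          L0_indic P (measurableC mA) * sup_seminorm Q u.
have sE : {ae P, forall w, s w = \1_A w * sup_seminorm Q v w +
                                 \1_(~` A) w * sup_seminorm Q u w}.
  near=> w; have -> : s w = L0_fun (L0_indic P mA * sup_seminorm Q v) w +
      L0_fun (L0_indic P (measurableC mA) * sup_seminorm Q u) w.
    by near: w; exact: L0_addE.
  have -> : L0_fun (L0_indic P mA * sup_seminorm Q v) w =
      L0_indic P mA w * sup_seminorm Q v w by near: w; exact: L0_mulE.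
  have -> : L0_fun (L0_indic P (measurableC mA) * sup_seminorm Q u) w =
      L0_indic P (measurableC mA) w * sup_seminorm Q u w.
    by near: w; exact: L0_mulE.
  rewrite (near (L0_indicE mA) w)//.
  by rewrite (near (L0_indicE (measurableC mA)) w).
have /L0_leP us : sup_seminorm Q u <= s.
  apply: lbu => _ [p Qp <-]; apply/L0_leP.
  have [_ _ /(_ p Qp) pE] := iQ.
  have /L0_leP pu : p u <= sup_seminorm Q u by apply: ubu; exists p.
  have /L0_leP pv : p v <= sup_seminorm Q v by apply: ubv; exists p.
  near=> w; rewrite (near sE w)// !indicE in_setC.
  have [wA|wA] /= := boolP (w \in A).
    rewrite mul1r mul0r addr0 (_ : p u w = p v w); first by near: w.
    by move/set_mem: wA; near: w; exact: seminorm_local uv.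
  by rewrite mul0r mul1r add0r; near: w.
apply: filterS2 us sE => w + + Aw => + swE.
by rewrite swE !indicE in_setC mem_set//= mul1r mul0r addr0.
Unshelve. all: by end_near. Qed.

(** Infinite values do no harm: 0 times an infinite value is 0, so at almost every point one summand
    vanishes and the other is added to 0. *)
Lemma stable_paste G f A (mA : measurable A) x y :
  L0_stable G f -> G x -> G y ->
  {ae P, forall w, f (paste mA x y) w = if w \in A then f x w else f y w}.
Proof.
move=> sf Gx Gy; rewrite /paste sf//.
set a := L0_indic P mA; set b := L0_indic P (measurableC mA).
near=> w.
have -> : L0bar_add (L0bar_mul (EFin_L0 a) (f x)) (L0bar_mul (EFin_L0 b) (f y)) w
   = dual_adde (L0bar_mul (EFin_L0 a) (f x) w) (L0bar_mul (EFin_L0 b) (f y) w).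
  by near: w; exact: toL0barE.
have -> : L0bar_mul (EFin_L0 a) (f x) w = (EFin_L0 a w * f x w)%E.
  by near: w; exact: toL0barE.
have -> : L0bar_mul (EFin_L0 b) (f y) w = (EFin_L0 b w * f y w)%E.
  by near: w; exact: toL0barE.
rewrite (near (EFin_L0E a) w)// (near (EFin_L0E b) w)//.
rewrite (near (L0_indicE mA) w)// (near (L0_indicE (measurableC mA)) w)//.
rewrite !indicE in_setC; case: (w \in A) => /=.
  by rewrite mul1e mul0e; exact: DualAddTheoryNumDomain.dadde0.
by rewrite mul1e mul0e; exact: DualAddTheoryNumDomain.dadd0e.
Unshelve. all: by end_near. Qed.

(** Pasting [x] onto [y] along [A] gives back [y], whose value on [A] is therefore that of [x]. *)
Lemma stable_local G f A (mA : measurable A) x y :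
  L0_stable G f -> G x -> G y ->
  L0_indic P mA *: x = L0_indic P mA *: y ->
  {ae P, forall w, A w -> f x w = f y w}.
Proof.
move=> sf Gx Gy /paste_eqr xy.
apply: filterS (stable_paste mA sf Gx Gy) => w + Aw.
by rewrite xy mem_set.
Qed.

End pasting.

(** * Events of probability close to 1 *)

Section probability_facts.
Context {d : measure_display} {T : measurableType d} {R : realType}.
Variable P : probability T R.
Implicit Types A B : set T.

Lemma le_measure_ae A B : measurable A -> measurable B ->
  {ae P, forall w, A w -> B w} -> (P A <= P B)%E.
Proof.
move=> mA mB [N [mN N0 ABN]]; rewrite -[leRHS](measureU0 mB mN N0).
rewrite le_measure ?inE//; first exact: measurableU.
move=> w Aw; have [Bw|nBw] := pselect (B w); first by left.
by right; apply: ABN => /= /(_ Aw).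
Qed.

Lemma ae_probability1 A : measurable A -> {ae P, forall w, A w} -> P A = 1%E.
Proof.
move=> mA aeA; apply/le_anti/andP; split; first exact: probability_le1.
rewrite -(probability_setT P); apply: le_measure_ae => //.
by apply: filterS aeA.
Qed.

(** [A] is covered by its intersection with [B] and the complement of [B], so the two errors add
    up. *)
Lemma probability_setI_gt A B (a b : R) : measurable A -> measurable B ->
  ((1 - a)%:E < P A)%E -> ((1 - b)%:E < P B)%E ->
  ((1 - (a + b))%:E < P (A `&` B))%E.
Proof.
move=> mA mB; have mAB := measurableI _ _ mA mB.
have : (P A <= P (A `&` B) + P (~` B))%E.
  apply: le_trans (measureU2 _ mAB (measurableC mB)).
  rewrite le_measure ?inE//; first exact/measurableU/measurableC.
  by move=> w Aw; have [Bw|nBw] := pselect (B w); [left|right].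
rewrite probability_setC// -(fineK (fin_num_measure P _ mA)).
rewrite -(fineK (fin_num_measure P _ mB)) -(fineK (fin_num_measure P _ mAB)).
rewrite -EFinB -EFinD !lte_fin lee_fin => *; lra.
Qed.

(** Continuity from below along the finite unions. *)
Lemma probability_bigcup_gt (A : nat -> set T) (lam : R) :
  (forall n, measurable (A n)) -> P (\bigcup_n A n) = 1%E -> 0 < lam ->
  exists n, ((1 - lam)%:E < P (\bigcup_(k < n) A k))%E.
Proof.
move=> mA UA1 lam0; pose C n := \bigcup_(k < n) A k.
have mC n : measurable (C n) by exact: bigcup_measurable.
have UC : \bigcup_n C n = \bigcup_n A n.
  apply/seteqP; split=> [w [n _ [k _ Akw]]|w [n _ Anw]]; first by exists k.
  by exists n.+1 => //; exists n => /=.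
have : P \o C @ \oo --> (1%:E : \bar R).
  rewrite -UA1 -UC; apply: nondecreasing_cvg_mu => //.
    by rewrite UC; exact: bigcup_measurable.
  move=> n m nm; apply/subsetPset => w [k /= kn Akw]; exists k => //=.
  exact: leq_trans nm.
move=> /fine_cvg /cvgr_gt /(_ (1 - lam)).
have l1 : 1 - lam < 1 by lra.
move=> /(_ l1) /filter_ex [n Cn]; exists n.
by rewrite -(fineK (fin_num_measure P _ (mC n))) lte_fin.
Qed.

(** Replaces a random radius by a constant one outside an event of small probability. Positivity of
    [e] makes these events exhaust the space up to a null set. *)
Lemma L0_pos_probability (e : L0 P) (lam : R) : L0_pos e -> 0 < lam ->
  exists n, ((1 - lam)%:E < P [set w | (n.+1%:R^-1 <= e w)%R])%E.
Proof.
move=> e0 lam0; pose A n := [set w | n.+1%:R^-1 <= e w].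
have mA n : measurable (A n).
  rewrite -[A n]setTI; apply: measurable_fun_le => //.
have [|n Pn] := probability_bigcup_gt mA _ lam0.
  apply: ae_probability1; first exact: bigcup_measurable.
  apply: filterS e0 => w ew.
  have [n _ /(_ n)] := near_infty_natSinv_lt (PosNum ew).
  by move=> /(_ (leqnn n)) /= /ltW ?; exists n.
(* The events increase with the index, so the union of the first [n] lies in the one of index
   [n]. *)
exists n; apply: (lt_le_trans Pn); rewrite le_measure ?inE//.
- exact: bigcup_measurable.
- exact: mA.
move=> w [k /= kn]; apply: le_trans.
by rewrite lef_pV2 ?posrE ?ltr0n// ler_nat ltnW.
Qed.

End probability_facts.

(** * Countable concatenation and comparison of the two topologies *)

Section concatenation.
Context {d : measure_display} {T : measurableType d} {R : realType}.
Context {P : probability T R} {E : randomLocallyConvexType P}.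
Implicit Types (x y : E) (G : set E) (f : E -> L0bar P).

(** Induction by pasting: [A n] is disjoint from the earlier pieces, so a change on [A n] preserves
    the earlier equations. *)
Lemma L0_convex_finite_concat G (g : nat -> E) (A : nat -> set T)
    (mA : forall n, measurable (A n)) (n : nat) :
  L0_convex G -> (forall k, G (g k)) -> trivIset setT A ->
  exists2 z, G z & forall k, (k < n)%N ->
    L0_indic P (mA k) *: z = L0_indic P (mA k) *: g k.
Proof.
move=> cG Gg tA; elim: n => [|n [z Gz zg]]; first by exists (g 0%N).
exists (paste (mA n) (g n) z); first exact: L0_convex_paste.
move=> k; rewrite ltnS leq_eqVlt => /orP[/eqP ->|kn].
  exact: indic_pastel.
rewrite indic_paster ?zg//; apply/disjoints_subset.
by move/trivIsetP : tA; apply=> //; rewrite ltn_eqF.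
Qed.

Lemma sup_seminorm0 Q : seminorm_index Q ->
  {ae P, forall w, sup_seminorm Q (0 : E) w = 0}.
Proof.
move=> iQ; have [fQ [p0 Qp0] QE] := iQ.
have p00 p : Q p -> p 0 = 0.
  move=> /QE pE; rewrite -(scale0r 0) (seminormZ _ pE).
  rewrite (_ : L0_abs 0 = 0) ?mul0r//; apply: L0P.
  apply: filterS2 (L0_absE (0 : L0 P)) (L0_zeroE P) => w -> h.
  by rewrite -[L0_fun 0 w]/(L0_fun (L0_zero P) w) h normr0.
have [ub lb] := sup_seminormP (0 : E) iQ.
have -> : sup_seminorm Q 0 = 0.
  apply/le_anti/andP; split; first by apply: lb => _ [p /p00 <- <-].
  by apply: ub; exists p0 => //; exact: p00.
exact: L0_zeroE.
Qed.

(** The concatenation [x] exists in [E]. Finite concatenations stay in [G] and agree with [x] on the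
    first [n] pieces, whose total probability tends to 1; they converge to [x], and closedness puts
    [x] in [G]. *)
Lemma eps_lambda_closed_concat G : countable_concatenation [set: E] ->
  eps_lambda_closed G -> L0_convex G -> countable_concatenation G.
Proof.
move=> cE clG cG g A mA Gg tA UA.
have [x _ xA] := cE g A mA (fun=> I) tA UA; exists x => //.
apply: contrapT => nGx.
have oG : eps_lambda_open (~` G).
  by rewrite -eps_lambda_openE; exact: closed_openC.
have [Q [e [l [iQ e0 /andP[l0 l1] QG]]]] := oG x nGx.
have [|n Pn] := @probability_bigcup_gt _ _ _ P _ _ mA _ l0.
  by rewrite UA probability_setT.
have [z Gz zA] := L0_convex_finite_concat mA n cG Gg tA.
(* On the first [n] pieces the seminorm of [z - x] is 0, below any [e > 0]; only [l] decides how
   large [n] must be. *)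
suff /QG : eps_lambda_nbhs0 Q e l (z - x) by exact.
rewrite /eps_lambda_nbhs0 /=; apply: (lt_le_trans Pn).
apply: le_measure_ae; first exact: bigcup_measurable.
  exact: measurable_sup_seminorm.
have zx0 k : {ae P, forall w, (k < n)%N -> A k w ->
    sup_seminorm Q (z - x) w = sup_seminorm Q 0 w}.
  have [kn|_] := ltnP k n; last by apply: aeW => w.
  have : L0_indic P (mA k) *: (z - x) = L0_indic P (mA k) *: 0.
    by rewrite scalerBr zA// xA subrr scaler0.
  by move/(sup_seminorm_local iQ); apply: filterS => w + _.
apply: filterS2 (ae_foralln zx0) (sup_seminorm0 iQ) => w zxw s0 [k /= kn Akw].
by rewrite (zxw k)// s0.
Qed.

(** Since a stable function is local, the bound by [eta] can be checked on each piece, discarding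
    countably many null sets. *)
Lemma sublevel_concat G f eta : L0_stable G f ->
  countable_concatenation G -> countable_concatenation (sublevel G f eta).
Proof.
move=> sf ccG g A mA Sg tA UA.
have [x Gx xA] := ccG g A mA (fun n => (Sg n).1) tA UA; exists x => //.
split=> //; apply/L0bar_leP.
have fx n : {ae P, forall w, A n w -> f x w = f (g n) w}.
  exact: (stable_local sf Gx (Sg n).1 (xA n)).
have fg n : {ae P, forall w, (f (g n) w <= EFin_L0 eta w)%E}.
  by apply/L0bar_leP; exact: (Sg n).2.
apply: filterS2 (ae_foralln fx) (ae_foralln fg) => w fxw fgw.
have [n _ Anw] : (\bigcup_n A n) w by rewrite UA.
by rewrite (fxw n).
Qed.

Lemma locL0_closed_eps_lambda G : countable_concatenation G ->
  locL0_closed G -> eps_lambda_closed G.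
Proof.
move=> ccG clG.
suff oG : eps_lambda_open (~` G).
  by rewrite /eps_lambda_closed -openC eps_lambda_openE.
have oG : locL0_open (~` G) by rewrite -locL0_openE; exact: closed_openC.
move=> x nGx; have [Q [e [iQ e0 QG]]] := oG x nGx.
apply: contrapT => nH.
(* By [nH] no neighbourhood of [x] built from this [Q] lies in the complement of [G], so each one
   meets [G]. *)
have near_x eps lam : 0 < eps -> 0 < lam < 1 ->
    exists2 y, G y & eps_lambda_nbhs0 Q eps lam (y - x).
  move=> eps0 lam01; apply: contrapT => nG; apply: nH; exists Q, eps, lam.
  by split=> // y yx Gy; apply: nG; exists y.
pose C y := [set w | sup_seminorm Q (y - x) w <= e w].
have mC y : measurable (C y).
  rewrite -[C y]setTI; apply: measurable_fun_le => //.
have /choice[y yP] n : exists y, G y /\ ((1 - n.+1%:R^-1)%:E < P (C y))%E.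
  have r0 : 0 < n.+1%:R^-1 :> R by rewrite invr_gt0 ltr0n.
  have r1 : n.+1%:R^-1 <= 1 :> R by rewrite invf_le1 ?ltr0n// ler1n.
  move: (n.+1%:R^-1 : R) r0 r1 => r r0 r1.
  (* One half of the error [r] pays for the event where [e] is below the constant [1/(m+1)], the
     other for the event where the seminorm of [z - x] is not. Halving also keeps the parameter
     below 1 when [n = 0]. *)
  have r20 : 0 < r / 2 by lra.
  have [m Pm] := L0_pos_probability e0 r20.
  have [||z Gz zx] := near_x m.+1%:R^-1 (r / 2).
  - by rewrite invr_gt0 ltr0n.
  - by apply/andP; split; lra.
  have me : measurable [set w | m.+1%:R^-1 <= e w].
    rewrite -[X in measurable X]setTI; apply: measurable_fun_le => //.
  exists z; split=> //; rewrite [r]splitr.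
  have mz := measurable_sup_seminorm Q (z - x) m.+1%:R^-1.
  apply: (lt_le_trans (probability_setI_gt mz me zx Pm)).
  rewrite le_measure ?inE//; first exact: measurableI.
  by move=> w [/= /ltW zw]; exact: le_trans.
pose B n := C (y n); pose U := \bigcup_n B n.
have mU : measurable U by apply: bigcup_measurable => n _; exact: mC.
have U1 : P U = 1%E.
  apply/le_anti/andP; split; first exact: probability_le1.
  (* [P U] dominates every [P (B n)], which exceeds [1 - 1/(n+1)]; take [n] with [1/(n+1) < r]. *)
  apply/lee_addgt0Pr => r r0.
  have [n _ /(_ n (leqnn n)) nr] := near_infty_natSinv_lt (PosNum r0).
  have {}nr : n.+1%:R^-1 < r by exact: nr.
  have : (P (B n) <= P U)%E.
    by rewrite le_measure ?inE//; [exact: mC|exact: bigcup_sup].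
  have := (yP n).2; rewrite -/(B n).
  rewrite -(fineK (fin_num_measure P _ (mC (y n)))).
  rewrite -(fineK (fin_num_measure P _ mU)) -EFinD !lte_fin !lee_fin.
  by move: (n.+1%:R^-1 : R) nr => s *; lra.
(* The null set missed by the B n is put in front to get a partition of T. *)
pose A n := if n is m.+1 then seqDU B m else ~` U.
have mA n : measurable (A n).
  case: n => [|n] /=; first exact: measurableC.
  by apply: seqDU_measurable => k; exact: mC.
have tA : trivIset setT A.
  have UB n : seqDU B n `<=` U.
    by move=> w Bw; rewrite /U seqDU_bigcup_eq; exists n.
  move=> [|i] [|j] _ _ //= [w []].
  - by move=> nU /UB.
  - by move=> /UB.
  - by move=> Bi Bj; congr S; apply: (@trivIset_seqDU _ B) => //; exists w.
have UA : \bigcup_n A n = setT.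
  apply/seteqP; split=> // w _; have [|nUw] := pselect (U w).
    by rewrite /U seqDU_bigcup_eq => -[n _ Bw]; exists n.+1.
  by exists 0%N.
(* The shift [n.-1] accounts for the null set at index 0, which simply receives [y 0]. *)
have [z Gz zA] := ccG (fun n => y n.-1) A mA (fun n => (yP n.-1).1) tA UA.
suff /QG : L0_nbhs0 Q e (z - x) by exact.
apply/L0_leP.
have zy n : {ae P, forall w, A n w ->
    sup_seminorm Q (z - x) w = sup_seminorm Q (y n.-1 - x) w}.
  by apply: (sup_seminorm_local iQ); rewrite !scalerBr zA.
have aeU : {ae P, forall w, U w}.
  exists (~` U); split=> //; first exact: measurableC.
  by rewrite probability_setC// U1 subee.
apply: filterS2 (ae_foralln zy) aeU => w zyw.
rewrite /U seqDU_bigcup_eq => -[n _ Bw]; rewrite (zyw n.+1)//=.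
exact: subset_seqDU Bw.
Qed.

End concatenation.

(** * Downward directedness of the values, and finite values as elements of [L0] *)

Section minimum.
Context {d : measure_display} {T : measurableType d} {R : realType}.
Context {P : probability T R} {E : randomLocallyConvexType P}.
Implicit Types (x y : E) (G : set E) (f : E -> L0bar P).

Lemma stable_directed G f x y : L0_convex G -> L0_stable G f -> G x -> G y ->
  exists2 z, G z & f z <= f x /\ f z <= f y.
Proof.
move=> cG sf Gx Gy; pose A := [set w | (f x w <= f y w)%E].
have mA : measurable A.
  rewrite -[A]setTI; apply: measurable_lee => //;
  exact: (measurable_funPT (L0bar_repr _)).
exists (paste mA x y); first exact: L0_convex_paste.
split; apply/L0bar_leP; apply: filterS (stable_paste mA sf Gx Gy) => w ->.
  by case: ifPn => // /negP; rewrite inE /A /= => /negP; rewrite -ltNge => /ltW.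
by case: ifPn => //; rewrite inE.
Qed.

(** Iterates directedness in the form needed for the finite intersection property; a point of [G]
    serves the empty list. *)
Lemma stable_directed_seq G f (s : seq E) : L0_convex G -> L0_stable G f ->
  G !=set0 -> (forall x, x \in s -> G x) ->
  exists2 z, G z & forall x, x \in s -> f z <= f x.
Proof.
move=> cG sf [x0 Gx0]; elim: s => [|a s IHs] sG; first by exists x0.
have [|z Gz zs] := IHs; first by move=> x xs; apply: sG; rewrite inE xs orbT.
have Ga : G a by apply: sG; rewrite mem_head.
have [t Gt [ta tz]] := stable_directed cG sf Ga Gz.
exists t => // x; rewrite inE => /orP[/eqP ->//|xs].
exact: le_trans (zs x xs).
Qed.

(** Lets a point with almost surely finite value index a sublevel set, whose level must lie in [L0];
    the witness is the class of [fine \o h]. *)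
Lemma EFin_L0_fine (h : L0bar P) : {ae P, forall w, h w \is a fin_num} ->
  exists xi : L0 P, h = EFin_L0 xi.
Proof.
move=> hfin.
have mh : measurable_fun setT (fine \o h).
  apply: measurableT_comp; first exact: fine_measurable.
  exact: (measurable_funPT (L0bar_repr h)).
exists (toL0 P (mfun_Sub (mem_set mh))); apply: L0barP.
near=> w.
have -> : EFin_L0 (toL0 P (mfun_Sub (mem_set mh))) w =
    (toL0 P (mfun_Sub (mem_set mh)) w)%:E by near: w; exact: EFin_L0E.
have -> : toL0 P (mfun_Sub (mem_set mh)) w = fine (h w).
  by near: w; exact: toL0E.
by rewrite fineK//; near: w.
Unshelve. all: by end_near. Qed.

End minimum.

Theorem theorem3p6 (R : realType) (d : measure_display) (T : measurableType d)
    (P : probability T R) (E : randomLocallyConvexType P)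
    (G : set E) (f : E -> L0bar P) :
  countable_concatenation [set: E] ->
  G !=set0 -> eps_lambda_closed G -> L0_convex G ->
  L0_proper G f -> L0_stable G f -> locL0_lsc G f -> L0_quasiconvex G f ->
  L0_convexly_compact G ->
  exists2 y0, G y0 & infimums [set f x | x in G] (f y0).
Proof.
move=> ccE G0 clG cG [fNy [x0 Gx0 [xi0 fx0]]] sf [_ lsc] [_ qc] [_ _ cpt].
have ccG := eps_lambda_closed_concat ccE clG cG.
(* Closedness and convexity are assumed only at levels in [L0]; for [x] in [D], the set [F x] is
   such a sublevel set. *)
pose D := [set x | G x /\ exists xi, f x = EFin_L0 xi].
pose F x := [set y | G y /\ f y <= f x].
(* Properness makes the index set nonempty, so a common point of the [F x] lies in [G]. *)
have Dx0 : D x0 by split=> //; exists xi0.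
have [||y0 y0F] := cpt E D F.
- move=> x [Gx [xi fx]]; have -> : F x = sublevel G f xi by rewrite /F fx.
  split; [by move=> y []| |exact: qc].
  by apply: locL0_closed_eps_lambda (lsc xi); exact: sublevel_concat.
- move=> X XD; have [|z Gz zX] := stable_directed_seq (s := finmap.enum_fset X) cG sf G0.
    by move=> x /XD; rewrite inE => -[].
  by exists z => x xX; split=> //; exact: zX.
have Gy0 : G y0 by have [] := y0F _ Dx0.
exists y0 => //; split; last by move=> t; apply; exists y0.
(* The value [f x] may be infinite, so [x] is first combined with [x0]: the resulting [z] has value
   at most [f x0], hence finite by properness, and [f y0 <= f z <= f x]. *)
move=> _ [x Gx <-]; have [z Gz [zx zx0]] := stable_directed cG sf Gx Gx0.
have Dz : D z.
  split=> //; apply: EFin_L0_fine; move: zx0; rewrite fx0 => /L0bar_leP zx0.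
  apply: filterS3 (fNy z Gz) zx0 (EFin_L0E xi0) => w fzNy fzx0 fx0w.
  by rewrite fin_real// fzNy (le_lt_trans fzx0)// fx0w ltry.
by apply: le_trans zx; have [] := y0F _ Dz.
Qed.
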